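(* Let $l_0\ge1$. For any $\alpha\in(0,1)$ and $\rho>0$, the boundary $$\mathrm{NM}_\alpha(v)=\sup\left\{s\in\mathbb{R}:\ \sqrt{\frac{4\rho}{v+\rho}}\exp\left\{\frac{s^2}{2(v+\rho)}\right\}\Phi\left(\frac{s}{\sqrt{v+\rho}}\right)<\frac{l_0}{\alpha}\right\}$$ is an $l_0$-sub-Gaussian uniform boundary with crossing probability $\alpha$. Furthermore, for $v\ge0$, $$\mathrm{NM}_\alpha(v)\le\widetilde{\mathrm{NM}}_\alpha(v):=\sqrt{2(v+\rho)\log\left(\frac{l_0}{2\alpha}\sqrt{\frac{v+\rho}{\rho}}+1\right)}.$$
   Context: $\Phi$ is the standard normal cumulative distribution function. Sub-$\psi$ condition: let $(S_t)_{t=0}^\infty$, $(V_t)_{t=0}^\infty$ be real-valued processes adapted to a filtration $(\mathcal F_t)_{t=0}^\infty$ with $S_0=V_0=0$ and $V_t\ge 0$ for all $t$. For $\psi:[0,\lambda_{\max})\to\mathbb{R}$ and $l_0\in[1,\infty)$, $(S_t)$ is $l_0$-sub-$\psi$ with variance process $(V_t)$ if for each $\lambda\in[0,\lambda_{\max})$ there is a supermartingale $(L_t(\lambda))_{t=0}^\infty$ with respect to $(\mathcal F_t)$ with $\mathbb{E}L_0(\lambda)\le l_0$ and $\exp\{\lambda S_t-\psi(\lambda)V_t\}\le L_t(\lambda)$ a.s. for all $t$. Uniform boundary: $u$ is an $l_0$-sub-$\psi$ uniform boundary with crossing probability $\alpha$ if $\mathbb{P}(\exists t\ge 1: S_t\ge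 u(V_t))\le\alpha$ for every pair $(S_t,V_t)$ such that $(S_t)$ is $l_0$-sub-$\psi$ with variance process $(V_t)$. Sub-Gaussian means sub-$\psi$ with $\psi(\lambda)=\lambda^2/2$ on $[0,\infty)$. *)

(* Defs.v *)
From mathcomp Require Import all_boot all_order all_algebra.
From mathcomp Require Import all_classical all_reals all_analysis.

Set Implicit Arguments.
Unset Strict Implicit.
Unset Printing Implicit Defensive.

Import Order.TTheory GRing.Theory Num.Theory.
Import numFieldNormedType.Exports.

Local Open Scope classical_set_scope.
Local Open Scope ring_scope.

Definition filtration d (T : measurableType d) (F : nat -> set (set T)) : Prop :=
  [/\ forall n, sigma_algebra setT (F n),
      forall n, F n `<=` measurable
    & forall m n, (m <= n)%N -> F m `<=` F n].

(* [measurable_fun] reads the sigma-algebra off the type of the domain, whereas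
   here it is an arbitrary sub-sigma-algebra [G]. *)
Definition measurable_wrt d (T : measurableType d) (R : realType)
    (G : set (set T)) (X : T -> R) : Prop :=
  forall B : set R, measurable B -> G (X @^-1` B).

Definition adapted d (T : measurableType d) (R : realType)
    (F : nat -> set (set T)) (X : nat -> T -> R) : Prop :=
  forall n, measurable_wrt (F n) (X n).

(* [Y] is a version of the conditional expectation of [X] given [G]. *)
Definition is_cond_expectation d (T : measurableType d) (R : realType)
    (P : probability T R) (G : set (set T)) (X Y : T -> R) : Prop :=
  [/\ measurable_wrt G Y,
      P.-integrable setT (EFin \o Y)
    & forall A, G A ->
        (\int[P]_(w in A) (Y w)%:E = \int[P]_(w in A) (X w)%:E)%E].

(* Versions of a conditional expectation exist and agree almost surely, so it
   does not matter which one is compared with [L n]. *)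
Definition supermartingale d (T : measurableType d) (R : realType)
    (P : probability T R) (F : nat -> set (set T)) (L : nat -> T -> R) : Prop :=
  [/\ adapted F L,
      forall n, P.-integrable setT (EFin \o L n)
    & forall n, exists2 Y : T -> R,
        is_cond_expectation P (F n) (L n.+1) Y
        & {ae P, forall w, Y w <= L n w}].

Definition process_pair d (T : measurableType d) (R : realType)
    (F : nat -> set (set T)) (S V : nat -> T -> R) : Prop :=
  [/\ filtration F,
      adapted F S /\ adapted F V,
      forall w, S 0%N w = 0 /\ V 0%N w = 0
    & forall n w, 0 <= V n w].

(* Only the values of [psi] on [0, lmax[ matter; [lmax] may be [+oo]. *)
Definition sub_psi d (T : measurableType d) (R : realType)
    (P : probability T R) (F : nat -> set (set T)) (l0 : R)
    (lmax : \bar R) (psi : R -> R) (S V : nat -> T -> R) : Prop :=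
  process_pair F S V /\
  forall l : R, 0 <= l -> (l%:E < lmax)%E ->
    exists L : nat -> T -> R,
      [/\ supermartingale P F L,
          ('E_P[L 0%N] <= l0%:E)%E
        & forall n, {ae P, forall w,
            expR (l * S n w - psi l * V n w) <= L n w}].

(* Only the values of [u] on [0, +oo[ matter. *)
Definition uniform_boundary (R : realType) (l0 : R) (lmax : \bar R)
    (psi : R -> R) (alpha : R) (u : R -> R) : Prop :=
  forall (d : measure_display) (T : measurableType d) (P : probability T R)
         (F : nat -> set (set T)) (S V : nat -> T -> R),
    sub_psi P F l0 lmax psi S V ->
    (P [set w | exists t, (1 <= t)%N /\ (u (V t w) <= S t w)%R] <= alpha%:E)%E.

Definition sub_gaussian_uniform_boundary (R : realType) (l0 alpha : R)
    (u : R -> R) : Prop :=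
  uniform_boundary l0 +oo%E (fun l => l ^+ 2 / 2) alpha u.

Definition Phi (R : realType) (x : R) : R :=
  fine (normal_prob 0 1 `]-oo, x]).

Definition NM (R : realType) (l0 alpha rho v : R) : R :=
  sup [set s : R |
    Num.sqrt (4 * rho / (v + rho)) * expR (s ^+ 2 / (2 * (v + rho)))
      * Phi (s / Num.sqrt (v + rho)) < l0 / alpha].

Definition NM_tilde (R : realType) (l0 alpha rho v : R) : R :=
  Num.sqrt (2 * (v + rho)
    * ln (l0 / (2 * alpha) * Num.sqrt ((v + rho) / rho) + 1)).

(* Main.v *)
Require Import Defs.
From HB Require Import structures.
From mathcomp Require Import all_boot all_order all_algebra.
From mathcomp Require Import all_classical all_reals all_analysis.
From mathcomp Require Import measurable_realfun ring lra.
Import Order.TTheory GRing.Theory Num.Theory.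
Import numFieldNormedType.Exports.
Local Open Scope classical_set_scope.
Local Open Scope ring_scope.
Set Implicit Arguments.
Unset Strict Implicit.

(* The quantity compared with l0 / alpha in the definition of NM is the mixture
   m(s, v) of exp(x s - x^2 v / 2) over the half-normal law of x >= 0 with
   precision rho (complete the square), and NM(v) <= s iff m(s, v) >= l0 / alpha.
   The supermartingales L(x) dominating exp(x S_t - x^2 V_t / 2) need not be
   measurable in x, so they are not mixed. Instead, let A_t be the event that t
   is the first time with m(S_t, V_t) >= c. This event does not depend on x, and
   optional stopping for L(x) gives, for each x >= 0 separately,
     sum_t int_{A_t} exp(x S_t - x^2 V_t / 2) dP <= l0.
   Integrating over x (Tonelli) gives sum_t int_{A_t} m(S_t, V_t) dP <= l0, hence
   c P(exists t, m(S_t, V_t) >= c) <= l0.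
   For the explicit bound, m(s, v) + m(-s, v) = 2 q exp(s^2 / (2 (v + rho))) with
   q = sqrt(rho / (v + rho)) = m(0, v), and m(-s, v) <= m(0, v) for s >= 0. *)

(** * The standard normal distribution function and a Gaussian integral *)

Lemma normal_pdf01E (R : realType) (x : R) :
  normal_pdf 0 1 x = (Num.sqrt (2 * pi))^-1 * expR (- (x ^+ 2 / 2)).
Proof.
rewrite /normal_pdf oner_eq0 /normal_peak /normal_fun.
by rewrite subr0 expr1n mul1r !mulr2n mulrDl !mul1r mulNr.
Qed.

(** By evenness of the density. The lower limit [- y] is the form produced by the change of
    variables in the Gaussian integral below. *)
Lemma Phi_right_tail (R : realType) (y : R) :
  (Phi y)%:E =
  (\int[lebesgue_measure]_(x in `[(- y)%R, +oo[) (normal_pdf 0 1 x)%:E)%E.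
Proof.
rewrite /Phi fineK ?fin_num_measure// /normal_prob -{1}(opprK y).
rewrite ge0_integration_by_substitutionNy.
- by apply: eq_integral => x _ /=; rewrite !normal_pdf01E sqrrN.
- apply: continuous_subspaceT; apply: continuous_normal_pdf; exact: oner_neq0.
- by move=> x _; exact: normal_pdf_ge0.
Qed.

Lemma PhiN (R : realType) (y : R) : Phi (- y) = 1 - Phi y.
Proof.
have tailE : (normal_prob 0 1 `]y, +oo[ = (Phi (- y))%:E :> \bar R)%E.
  rewrite Phi_right_tail opprK /normal_prob integral_itv_obnd_cbnd//.
  by apply: measurable_funTS; apply/measurable_EFinP; exact: measurable_normal_pdf.
have PhiE : normal_prob 0 1 `]-oo, y] = (Phi y)%:E :> \bar R.
  by rewrite /Phi fineK// fin_num_measure.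
have : (normal_prob 0 1 `]-oo, y] + normal_prob 0 1 `]y, +oo[ = 1 :> \bar R)%E.
  rewrite -measureU//; last by rewrite -setCitvl setICr.
  rewrite -setCitvl setUv.
  exact: (@probability_setT _ _ _ (normal_prob 0 1 : probability _ R)).
by rewrite PhiE tailE => -[]; lra.
Qed.

Lemma Phi0 (R : realType) : Phi 0 = 2^-1 :> R.
Proof. by have := PhiN (0 : R); rewrite oppr0; lra. Qed.

(** [Phi] is the [cdf] of the identity random variable under the standard normal law. *)
Lemma Phi_right_continuous (R : realType) : right_continuous (@Phi R).
Proof.
move=> a.
have mid : measurable_fun setT (idfun : measurableTypeR R -> R).
  exact: measurable_id.
pose X : {RV (normal_prob 0 1 : probability _ R) >-> R} :=
  HB.pack (idfun : measurableTypeR R -> R) (isMeasurableFun.Build _ _ _ _ _ mid).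
have := @cdf_right_continuous _ _ _ _ X a.
have XE r : cdf X r = (Phi r)%:E by rewrite /cdf /Phi fineK// fin_num_measure.
rewrite (_ : cdf X = EFin \o @Phi R); last by apply/funext => r; exact: XE.
by move=> /fine_cvg.
Qed.

(** With [b = Num.sqrt a], the exponent equals [s^2 / (2 a) - (b x - s / b)^2 / 2]; then substitute
    [y = b x - s / b]. *)
Lemma integral_expR_quadratic (R : realType) (a s : R) : 0 < a ->
  (\int[lebesgue_measure]_(x in `[0%R, +oo[)
      (expR (x * s - a * x ^+ 2 / 2))%:E =
   (Num.sqrt (2 * pi / a) * expR (s ^+ 2 / (2 * a)) * Phi (s / Num.sqrt a))%:E)%E.
Proof.
move=> a0; set b := Num.sqrt a; have b0 : 0 < b by rewrite sqrtr_gt0.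
have -> : a = b ^+ 2 by rewrite sqr_sqrtr ?ltW.
pose F (x : R^o) := b * x - s / b.
have F'E : F^`()%classic = cst b.
  apply/funext => x; rewrite /F derive1E deriveB// deriveM// !derive_cst scaler0.
  by rewrite subr0 addr0 derive_id scaler1.
have cF : continuous F.
  move=> x; apply: (@cvgB _ R^o); last exact: cvg_cst.
  by apply: cvgM; [exact: cvg_cst|exact: cvg_id].
rewrite EFinM Phi_right_tail.
have -> : - (s / b) = F 0 by rewrite /F mulr0 sub0r.
rewrite increasing_ge0_integration_by_substitutiony; last first.
- by move=> x _; exact: normal_pdf_ge0.
- by apply: continuous_subspaceT; apply: continuous_normal_pdf; exact: oner_neq0.
- apply/cvgryPge => A; near=> x; rewrite /F lerBrDr -ler_pdivrMl//; near: x.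
- split; last by apply: cvg_at_right_filter; exact: cF.
  by move=> x _; rewrite /F; exact: derivableB.
- by rewrite F'E; exact: is_cvg_cst.
- by rewrite F'E; exact: is_cvg_cst.
- by rewrite F'E => ? _; exact: cvg_cst.
- by move=> x y _ _ xy; rewrite /F ltrD2r ltr_pM2l.
rewrite F'E -ge0_integralZl_EFin//; last 2 first.
- by move=> x _; rewrite lee_fin mulr_ge0 ?normal_pdf_ge0 ?ltW.
- apply: measurable_funTS; apply/measurable_EFinP; apply: measurable_funM => //.
  apply: measurableT_comp; first exact: measurable_normal_pdf.
  exact: continuous_measurable_fun.
apply: eq_integral => x _; rewrite -EFinM; congr EFin.
rewrite !fctE /= normal_pdf01E /F sqrtrM ?mulr_ge0 ?pi_ge0// sqrtrV ?sqr_ge0//.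
rewrite sqrtr_sqr ger0_norm ?ltW//.
have -> : Num.sqrt (2 * pi) / b * expR (s ^+ 2 / (2 * b ^+ 2)) *
  ((Num.sqrt (2 * pi))^-1 * expR (- ((b * x - s / b) ^+ 2 / 2)) * b) =
  expR (s ^+ 2 / (2 * b ^+ 2)) * expR (- ((b * x - s / b) ^+ 2 / 2)).
  field; rewrite (gt_eqF b0) andbT gt_eqF// sqrtr_gt0.
  by rewrite mulr_gt0 ?pi_gt0.
rewrite -expRD; congr expR.
by field; rewrite (gt_eqF b0).
Unshelve. all: by end_near. Qed.

(** * Optional stopping at a first entrance time *)

(** [seqDU E n] says that [n] is the first index whose event occurs, the complement that no [E k]
    with [k <= n] has occurred; both are decided at time [n]. *)
Lemma filtration_seqDU d (T : measurableType d) (F : nat -> set (set T))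
    (E : nat -> set T) : filtration F -> (forall k, F k (E k)) ->
  (forall n, F n (seqDU E n)) /\
  (forall n, F n (~` \big[setU/set0]_(k < n.+1) E k)).
Proof.
move=> [sF _ leF] FE.
have FU n : F n (\big[setU/set0]_(k < n.+1) E k).
  rewrite -(measurable_g_measurableTypeE (sF n)).
  apply: bigsetU_measurable => k _; rewrite (measurable_g_measurableTypeE (sF n)).
  by apply: (leF k) => //; rewrite -ltnS.
split=> n; last first.
  rewrite -(measurable_g_measurableTypeE (sF n)); apply: measurableC.
  by rewrite (measurable_g_measurableTypeE (sF n)).
rewrite -(measurable_g_measurableTypeE (sF n)); apply: measurableD.
  by rewrite (measurable_g_measurableTypeE (sF n)).
apply: bigsetU_measurable => k _; rewrite (measurable_g_measurableTypeE (sF n)).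
by apply: (leF k) => //; rewrite ltnW.
Qed.

(** Reduces to nonnegative functions: [f <= g] orders the positive parts the same way and the
    negative parts the opposite way. *)
Lemma ae_le_integral d (T : measurableType d) (R : realType)
    (mu : {measure set T -> \bar R}) (D : set T) (f g : T -> \bar R) :
  measurable D -> measurable_fun D f -> measurable_fun D g ->
  {ae mu, forall x, D x -> (f x <= g x)%E} ->
  (\int[mu]_(x in D) f x <= \int[mu]_(x in D) g x)%E.
Proof.
move=> mD mf mg fg; rewrite integralE [leRHS]integralE leeB//.
- apply: ae_ge0_le_integral => //; [exact: measurable_funepos..|].
  apply: filterS fg => x fg Dx; rewrite !funeposE ge_max le_max fg//=.
  by rewrite le_max lexx orbT.
- apply: ae_ge0_le_integral => //; [exact: measurable_funeneg..|].
  apply: filterS fg => x fg Dx; rewrite !funenegE ge_max le_max leeN2 fg//=.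
  by rewrite le_max lexx orbT.
Qed.

Lemma supermartingale_integral_le d (T : measurableType d) (R : realType)
    (P : probability T R) (F : nat -> set (set T)) (L : nat -> T -> R)
    (n : nat) (A : set T) :
  filtration F -> supermartingale P F L -> F n A ->
  (\int[P]_(w in A) (L n.+1 w)%:E <= \int[P]_(w in A) (L n w)%:E)%E.
Proof.
move=> [_ mF _] [_ iL]; move=> /(_ n) [Y [_ iY YL] YleL] FA.
have mA : measurable A by exact: mF FA.
rewrite -YL//; apply: ae_le_integral => //.
- exact/measurable_funTS/(measurable_int _ iY).
- exact/measurable_funTS/(measurable_int _ (iL n)).
- by apply: filterS YleL => w Yw _; rewrite lee_fin.
Qed.

(** Optional stopping written as a sum over the values of the first entrance time, truncated at
    [n]. *)
Lemma seqDU_sum_integral_le d (T : measurableType d) (R : realType)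
    (P : probability T R) (F : nat -> set (set T)) (L : nat -> T -> R)
    (E : nat -> set T) (n : nat) :
  filtration F -> supermartingale P F L ->
  (forall k, {ae P, forall w, 0 <= L k w}) ->
  (forall k, F k (E k)) ->
  (\sum_(k < n) \int[P]_(w in seqDU E k) (L k w)%:E <= 'E_P[L 0%N])%E.
Proof.
move=> fF sL L0 FE.
have [_ mF _] := fF.
have [FS FC] := filtration_seqDU fF FE.
have mS k : measurable (seqDU E k) by exact: mF (FS k).
have mC k : measurable (~` \big[setU/set0]_(i < k) E i).
  by apply: measurableC; apply: bigsetU_measurable => i _; exact: mF (FE i).
have mL k : measurable_fun setT (EFin \o L k).
  by have [_ iL _] := sL; exact: measurable_int (iL k).
(* Invariant: the part stopped before [m] plus the part still running at [m]. In the step the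
   running event splits into what stops at [m] and what goes on; the latter lies in [F m], so the
   supermartingale inequality applies to it. *)
have key m : (\sum_(k < m) \int[P]_(w in seqDU E k) (L k w)%:E +
   \int[P]_(w in ~` (\big[setU/set0]_(i < m) E i)) (L m w)%:E <= 'E_P[L 0%N])%E.
  elim: m => [|m IH]; first by rewrite !big_ord0 setC0 add0e unlock.
  rewrite big_ord_recr/=; apply: le_trans IH; rewrite -addeA.
  apply: leeD2l.
  have -> : (~` (\big[setU/set0]_(i < m) E i)) =
      seqDU E m `|` ~` (\big[setU/set0]_(i < m.+1) E i).
    rewrite big_ord_recr/= /seqDU setDE setCU -[LHS]setTI setIC.
    by rewrite (setIC (~` _) (~` E m)) -setIUl setUv setIC.
  rewrite integral_setU//; first last.
  - rewrite disj_set2E; apply/eqP; rewrite -subset0 => w [[Em _]].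
    by rewrite big_ord_recr/=; apply; right.
  - exact: measurable_funTS (mL m).
  by apply: leeD2l; exact: (supermartingale_integral_le fF sL (FC m)).
apply: le_trans (key n); apply: leeDl.
rewrite -(@integral0 _ _ _ P (~` (\big[setU/set0]_(i < n) E i))).
apply: ae_le_integral => //; first exact: measurable_funTS (mL n).
by apply: filterS (L0 n) => w Lw _; rewrite lee_fin.
Qed.

(** * The half-normal mixture *)

(** For [rho > 0], the density of [|Z|] with [Z] centred normal of variance [1 / rho], extended by
    zero to the whole line. *)
Definition half_normal_pdf (R : realType) (rho x : R) : R :=
  \1_`[0, +oo[ x * (Num.sqrt (2 * rho / pi) * expR (- (rho * x ^+ 2 / 2))).

Definition half_normal_mixture (R : realType) (rho s v : R) : \bar R :=
  (\int[lebesgue_measure]_x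
    (half_normal_pdf rho x * expR (x * s - x ^+ 2 / 2 * v))%:E)%E.

(** Closed form of the mixture for [v >= 0]; [NM] is the supremum of its strict sublevel set at
    [l0 / alpha]. *)
Definition NM_stat (R : realType) (rho v s : R) : R :=
  Num.sqrt (4 * rho / (v + rho)) * expR (s ^+ 2 / (2 * (v + rho)))
    * Phi (s / Num.sqrt (v + rho)).

Lemma half_normal_pdf_ge0 (R : realType) (rho x : R) : 0 <= half_normal_pdf rho x.
Proof. by rewrite !mulr_ge0 ?expR_ge0. Qed.

Lemma half_normal_pdf_lt0 (R : realType) (rho x : R) : x < 0 -> half_normal_pdf rho x = 0.
Proof.
by move=> x0; rewrite /half_normal_pdf indicE memNset ?mul0r//= in_itv/= leNgt x0.
Qed.

Lemma measurable_half_normal_pdf (R : realType) (rho : R) :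
  measurable_fun setT (@half_normal_pdf R rho).
Proof.
apply: measurable_funM; first exact: measurable_indic.
apply: measurable_funM => //; apply: measurableT_comp => //.
apply: measurableT_comp => //; apply: measurable_funM => //.
by apply: measurable_funM => //; exact: measurable_funX.
Qed.

Lemma half_normal_mixtureE (R : realType) (rho s v : R) : 0 < rho -> 0 <= v ->
  half_normal_mixture rho s v = (NM_stat rho v s)%:E.
Proof.
move=> rho0 v0; have a0 : 0 < v + rho by rewrite ltr_wpDl.
have p0 : 0 < pi :> R := pi_gt0 R.
transitivity (\int[lebesgue_measure]_(x in `[0%R, +oo[)
   ((Num.sqrt (2 * rho / pi))%:E * (expR (x * s - (v + rho) * x ^+ 2 / 2))%:E))%E.
  rewrite [RHS]integral_mkcond; apply: eq_integral => x _.
  rewrite /half_normal_pdf indicE patchE; case: ifPn => _; last by rewrite !mul0r.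
  rewrite -EFinM mul1r -(mulrA (Num.sqrt _)) -expRD; congr (_ * expR _)%:E.
  by field.
rewrite ge0_integralZl_EFin//; last first.
- apply: measurable_funTS; apply/measurable_EFinP; apply: measurableT_comp => //.
  apply: measurable_funB; first exact: measurable_funM.
  by apply: measurable_funM => //; apply: measurable_funM => //; exact: measurable_funX.
rewrite integral_expR_quadratic// -EFinM /NM_stat !mulrA; congr (_ * _ * _)%:E.
(* The constants combine: [(2 rho / pi) * (2 pi / (v + rho)) = 4 rho / (v + rho)]. *)
rewrite -sqrtrM ?divr_ge0 ?mulr_ge0 ?ltW//; congr Num.sqrt.
by move: (pi : R) p0 => p p0; field; rewrite !gt_eqF.
Qed.

Lemma sqrtr4 (R : rcfType) : Num.sqrt 4 = 2 :> R.
Proof. by rewrite (_ : 4 = 2 ^+ 2) ?sqrtr_sqr ?ger0_norm// -natrX. Qed.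

Lemma half_normal_mixture00 (R : realType) (rho : R) : 0 < rho ->
  half_normal_mixture rho 0 0 = 1%E.
Proof.
move=> rho0; rewrite half_normal_mixtureE// /NM_stat add0r expr0n !mul0r expR0.
by rewrite mulr1 Phi0 mulfK ?gt_eqF// sqrtr4 divff.
Qed.

Lemma measurable_expR_tilt d (T : measurableType d) (R : realType)
    (X S V : T -> R) :
  measurable_fun setT X -> measurable_fun setT S -> measurable_fun setT V ->
  measurable_fun setT (fun w => expR (X w * S w - X w ^+ 2 / 2 * V w)).
Proof.
move=> mX mS mV; apply: measurableT_comp => //.
apply: measurable_funB; apply: measurable_funM => //.
by apply: measurable_funM => //; exact: measurable_funX.
Qed.

Lemma measurable_half_normal_tilt d (T : measurableType d) (R : realType)
    (rho : R) (S V : T -> R) :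
  measurable_fun setT S -> measurable_fun setT V ->
  measurable_fun setT (fun q : T * measurableTypeR R =>
    half_normal_pdf rho q.2 * expR (q.2 * S q.1 - q.2 ^+ 2 / 2 * V q.1)).
Proof.
move=> mS mV; apply: measurable_funM.
  apply: measurableT_comp; [exact: measurable_half_normal_pdf|exact: measurable_snd].
apply: (measurable_expR_tilt (X := snd : T * measurableTypeR R -> R)).
- exact: measurable_snd.
- by apply: measurableT_comp => //; exact: measurable_fst.
- by apply: measurableT_comp => //; exact: measurable_fst.
Qed.

(** Stated for any measurable type [T], so that it serves both the ambient sigma-algebra and
    [F t]. *)
Lemma measurable_half_normal_mixture d (T : measurableType d) (R : realType)
    (rho : R) (S V : T -> R) :
  measurable_fun setT S -> measurable_fun setT V ->
  measurable_fun setT (fun w => half_normal_mixture rho (S w) (V w)).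
Proof.
move=> mS mV.
pose f (q : T * measurableTypeR R) : \bar R :=
  (half_normal_pdf rho q.2 * expR (q.2 * S q.1 - q.2 ^+ 2 / 2 * V q.1))%:E.
apply: (measurable_fun_fubini_tonelli_F (m2 := lebesgue_measure) f).
- by apply/measurable_EFinP; exact: measurable_half_normal_tilt.
- by move=> x; rewrite lee_fin mulr_ge0 ?half_normal_pdf_ge0 ?expR_ge0.
Qed.

(** Tonelli on the product, with [\1_A] absorbed into the integrand. Measurability of [g] is
    recorded for the later exchange of sum and integral. *)
Lemma half_normal_mixture_tonelli d (T : measurableType d) (R : realType)
    (P : probability T R) (A : set T) (rho : R) (S V : T -> R) :
  measurable A -> measurable_fun setT S -> measurable_fun setT V ->
  let g x := ((half_normal_pdf rho x)%:E *
     \int[P]_(w in A) (expR (x * S w - x ^+ 2 / 2 * V w))%:E)%E in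
  measurable_fun setT (g : measurableTypeR R -> \bar R) /\
  (\int[P]_(w in A) half_normal_mixture rho (S w) (V w) =
   \int[lebesgue_measure]_x g x)%E.
Proof.
move=> mA mS mV g.
pose f (q : T * measurableTypeR R) : \bar R := ((\1_A q.1)%:E *
  (half_normal_pdf rho q.2 * expR (q.2 * S q.1 - q.2 ^+ 2 / 2 * V q.1))%:E)%E.
have f0 q : (0 <= f q)%E.
  by rewrite mule_ge0// lee_fin// mulr_ge0 ?half_normal_pdf_ge0 ?expR_ge0.
have mf : measurable_fun setT f.
  apply: emeasurable_funM; apply/measurable_EFinP.
    by apply: measurableT_comp => //; exact: measurable_fst.
  exact: measurable_half_normal_tilt.
have gE x : g x = (\int[P]_w f (w, x))%E.
  rewrite /g -ge0_integralZl_EFin ?half_normal_pdf_ge0//.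
    rewrite [LHS]integral_mkcond epatch_indic.
    by apply: eq_integral => w _; rewrite /f /= [LHS]muleC -EFinM.
  apply: measurable_funTS; apply/measurable_EFinP.
  exact: (@measurable_expR_tilt _ T R (cst x)).
split.
  rewrite (_ : g = fubini_G P f); last by apply/funext => x; exact: gE.
  exact: measurable_fun_fubini_tonelli_G.
transitivity (\int[P]_w \int[lebesgue_measure]_x f (w, x))%E; last first.
  by rewrite fubini_tonelli//; apply: eq_integral => x _; rewrite gE.
rewrite integral_mkcond epatch_indic; apply: eq_integral => w _ /=.
rewrite muleC -ge0_integralZl_EFin//.
- by move=> x _; rewrite lee_fin mulr_ge0 ?half_normal_pdf_ge0 ?expR_ge0.
- apply/measurable_EFinP; apply: measurable_funM.
    exact: measurable_half_normal_pdf.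
  by apply: (@measurable_expR_tilt _ (measurableTypeR R) R idfun (cst (S w))
    (cst (V w))) => //; exact: measurable_id.
Qed.

(** Moves [G] into the type of the domain, where [measurable_fun] reads it. *)
Lemma measurable_wrt_measurable_fun d (T : measurableType d) (R : realType)
    (G : set (set T)) (X : T -> R) : sigma_algebra setT G ->
  measurable_wrt G X ->
  measurable_fun setT (X : g_sigma_algebraType G -> R).
Proof.
move=> sG GX _ B mB; rewrite setTI (measurable_g_measurableTypeE sG).
exact: GX.
Qed.

Lemma filtration_measurable_fun d (T : measurableType d) (R : realType)
    (F : nat -> set (set T)) (X : nat -> T -> R) (n : nat) :
  filtration F -> adapted F X -> measurable_fun setT (X n).
Proof. by move=> [_ mF _] FX _ B mB; rewrite setTI; apply/mF/FX. Qed.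

(** * The maximal inequality for the mixture *)

Lemma half_normal_mixture_maximal d (T : measurableType d) (R : realType)
    (P : probability T R) (F : nat -> set (set T)) (l0 rho c : R)
    (S V : nat -> T -> R) :
  0 < rho -> 0 < c ->
  sub_psi P F l0 +oo%E (fun l => l ^+ 2 / 2) S V ->
  let E t := [set w | (c%:E <= half_normal_mixture rho (S t w) (V t w))%E] in
  (forall t, measurable (E t)) /\ (P (\bigcup_t E t) <= (l0 / c)%:E)%E.
Proof.
move=> rho0 c0 [[fF [FS FV] SV0 V0] sub] E.
have [sF mF _] := fF.
have mS t : measurable_fun setT (S t) := filtration_measurable_fun t fF FS.
have mV t : measurable_fun setT (V t) := filtration_measurable_fun t fF FV.
have FE t : F t (E t).
  rewrite -(measurable_g_measurableTypeE (sF t)) -[E t]setTI.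
  apply: emeasurable_fun_c_infty => //.
  apply: measurable_half_normal_mixture;
    by [exact: measurable_wrt_measurable_fun (sF t) (FS t)
       |exact: measurable_wrt_measurable_fun (sF t) (FV t)].
have mE t : measurable (E t) by exact: mF (FE t).
have mD t : measurable (seqDU E t) by exact: seqDU_measurable.
split=> //.
have mix_ge0 s v : (0 <= half_normal_mixture rho s v)%E.
  by apply: integral_ge0 => x _; rewrite lee_fin mulr_ge0 ?half_normal_pdf_ge0 ?expR_ge0.
(* Here [x] is fixed and [L] is chosen for this [x] alone; the resulting bound no longer mentions
   [L]. *)
have tilt n x : 0 <= x -> (\sum_(t < n) \int[P]_(w in seqDU E t)
    (expR (x * S t w - x ^+ 2 / 2 * V t w))%:E <= l0%:E)%E.
  move=> x0; have [L [sL L0 leL]] := sub x x0 (ltry _).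
  have L_ge0 t : {ae P, forall w, 0 <= L t w}.
    by apply: filterS (leL t) => w; apply: le_trans; exact: expR_ge0.
  apply: le_trans L0; apply: le_trans (seqDU_sum_integral_le n fF sL L_ge0 FE).
  apply: lee_sum => t _; apply: ae_le_integral => //.
  - apply: measurable_funTS; apply/measurable_EFinP.
    exact: (@measurable_expR_tilt _ T R (cst x)).
  - have [_ iL _] := sL.
    exact/measurable_funTS/(measurable_int _ (iL t)).
  - by apply: filterS (leL t) => w + _; rewrite lee_fin.
(* The empty sum is bounded by [l0]. *)
have l0_ge0 : 0 <= l0 by have := tilt 0%N 0 (lexx _); rewrite big_ord0 lee_fin.
have fin n : (\sum_(0 <= t < n) P (seqDU E t) <= (l0 / c)%:E)%E.
  rewrite big_mkord EFinM lee_pdivlMr// muleC ge0_sume_distrr//.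
  (* Markov: the mixture is at least [c] on [seqDU E t], a subset of [E t]. *)
  apply: (@le_trans _ _ (\sum_(t < n) \int[P]_(w in seqDU E t)
      half_normal_mixture rho (S t w) (V t w))%E).
    apply: lee_sum => t _; rewrite -integral_cst//; apply: ge0_le_integral => //.
    - by move=> w _; rewrite lee_fin ltW.
    - by apply: measurable_funTS; exact: measurable_half_normal_mixture.
    - by move=> w wD; exact: (@subset_seqDU _ E t w wD).
  under eq_bigr => t _ do
    rewrite (half_normal_mixture_tonelli P rho (mD t) (mS t) (mV t)).2.
  have mg t := (half_normal_mixture_tonelli P rho (mD t) (mS t) (mV t)).1.
  have g0 t x : (0 <= (half_normal_pdf rho x)%:E * \int[P]_(w in seqDU E t)
       (expR (x * S t w - x ^+ 2 / 2 * V t w))%:E)%E.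
    by rewrite mule_ge0 ?lee_fin ?half_normal_pdf_ge0// integral_ge0.
  rewrite -ge0_integral_sum//.
  apply: (@le_trans _ _ (\int[lebesgue_measure]_x
      (l0%:E * (half_normal_pdf rho x)%:E))%E).
    apply: ge0_le_integral => //.
    - by move=> x _; apply: sume_ge0.
    - by apply: emeasurable_sum => t; exact: mg.
    - apply: emeasurable_funM => //; apply/measurable_EFinP.
      exact: measurable_half_normal_pdf.
    - move=> x _; rewrite -ge0_sume_distrr; last by move=> t _; rewrite integral_ge0.
      have [x0|x0] := leP 0 x; last by rewrite half_normal_pdf_lt0// mul0e mule0.
      by rewrite muleC lee_wpmul2r ?lee_fin ?half_normal_pdf_ge0// tilt.
  rewrite ge0_integralZl_EFin//.
  (* The density has mass one, being the mixture at [s = v = 0]. *)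
  - rewrite -[leRHS]mule1 -(half_normal_mixture00 rho0) /half_normal_mixture.
    by under [in leRHS]eq_integral => x _ do rewrite !mulr0 subr0 expR0 mulr1.
  - by move=> x _; rewrite lee_fin half_normal_pdf_ge0.
  - by apply/measurable_EFinP; exact: measurable_half_normal_pdf.
have mDU : measurable (\bigcup_t seqDU E t) by exact: bigcupT_measurable.
have PD := @measure_semi_sigma_additive _ _ _ P _ mD (trivIset_seqDU E) mDU.
(* The disjoint events have the same union as the [E t], so its probability is the limit of the
   partial sums just bounded. *)
rewrite seqDU_bigcup_eq -(cvg_lim _ PD)//.
apply: lime_le; first by apply/cvg_ex; eexists; exact: PD.
exact: nearW.
Qed.

(** * The boundary and its explicit bound *)

(** Read off the integral: for [x >= 0] the tilt is nondecreasing in [s], and negative [x] carry no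
    weight. *)
Lemma NM_stat_nondecreasing (R : realType) (rho v : R) : 0 < rho -> 0 <= v ->
  {homo NM_stat rho v : s t / s <= t}.
Proof.
move=> rho0 v0 s t st; rewrite -lee_fin -!half_normal_mixtureE//.
have mtilt (u : R) : measurable_fun setT (fun x : measurableTypeR R =>
    (half_normal_pdf rho x * expR (x * u - x ^+ 2 / 2 * v))%:E).
  apply/measurable_EFinP; apply: measurable_funM.
    exact: measurable_half_normal_pdf.
  by apply: (@measurable_expR_tilt _ (measurableTypeR R) R idfun (cst u) (cst v))
    => //; exact: measurable_id.
apply: ge0_le_integral => //.
- by move=> x _; rewrite lee_fin mulr_ge0 ?half_normal_pdf_ge0 ?expR_ge0.
- move=> x _; rewrite lee_fin; have [x0|x0] := leP 0 x; last first.
    by rewrite half_normal_pdf_lt0// !mul0r.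
  by rewrite ler_wpM2l ?half_normal_pdf_ge0// ler_expR lerD2r ler_wpM2l.
Qed.

Lemma NM_statDN (R : realType) (rho v s : R) :
  NM_stat rho v s + NM_stat rho v (- s) =
  Num.sqrt (4 * rho / (v + rho)) * expR (s ^+ 2 / (2 * (v + rho))).
Proof. by rewrite /NM_stat sqrrN mulNr PhiN; ring. Qed.

Lemma NM_stat0 (R : realType) (rho v : R) :
  NM_stat rho v 0 = Num.sqrt (rho / (v + rho)).
Proof.
rewrite /NM_stat expr0n !mul0r expR0 mulr1 Phi0 -mulrA sqrtrM//.
by rewrite sqrtr4 mulrAC divff ?mul1r.
Qed.

(** By right continuity; it shows that the strict sublevel set has no largest element. *)
Lemma NM_stat_right_lt (R : realType) (rho v c s : R) : 0 < v + rho ->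
  NM_stat rho v s < c -> exists2 t, s < t & NM_stat rho v t < c.
Proof.
move=> a0 sc; set k := (Num.sqrt (v + rho))^-1.
have k0 : 0 < k by rewrite invr_gt0 sqrtr_gt0.
(* Scaling by [k > 0] preserves right neighbourhoods, which lets the one-sided continuity of [Phi]
   be composed. *)
have cscale : x * k @[x --> s^'+] --> (s * k)^'+.
  move=> B skB.
  have cs : x * k @[x --> s] --> s * k by apply: cvgM; [exact: cvg_id|exact: cvg_cst].
  have near_s : \forall x \near s, s * k < x * k -> B (x * k) := cs _ skB.
  apply: (@filterS _ (nbhs s) _ _ _ _ near_s) => x /= + sx; apply.
  by rewrite ltr_pM2r.
have cstat : NM_stat rho v x @[x --> s^'+] --> NM_stat rho v s.
  apply: cvgM.
    apply: cvgM; first exact: cvg_cst.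
    apply: cvg_at_right_filter.
    apply: continuous_comp; last exact: continuous_expR.
    by apply: cvgM; [exact: exprn_continuous|exact: cvg_cst].
  by apply: (cvg_comp _ _ cscale); exact: Phi_right_continuous.
have /filter_ex[t []] : \forall x \near s^'+, s < x /\ NM_stat rho v x < c.
  near=> x; split; first by near: x; exact: nbhs_right_gt.
  by near: x; exact: (cvgr_lt _ cstat).
by exists t.
Unshelve. all: by end_near. Qed.

(** Makes [NM_tilde] an upper bound of the set whose supremum is [NM]. For negative [s] the sign of
    the square root suffices; otherwise the claim reduces to [e <= X] below. *)
Lemma le_NM_tilde (R : realType) (l0 alpha rho v s : R) :
  0 < l0 -> 0 < alpha -> 0 < rho -> 0 <= v ->
  NM_stat rho v s < l0 / alpha -> s <= NM_tilde l0 alpha rho v.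
Proof.
move=> l00 alpha0 rho0 v0 sc; have a0 : 0 < v + rho by rewrite ltr_wpDl.
have [s0|s0] := leP 0 s; last by rewrite (le_trans (ltW s0))// sqrtr_ge0.
rewrite (le_trans (ler_norm s))// -sqrtr_sqr /NM_tilde ler_wsqrtr//.
rewrite -ler_pdivrMl ?mulr_gt0// mulrC.
set q := Num.sqrt (rho / (v + rho)).
have q0 : 0 < q by rewrite sqrtr_gt0 divr_gt0.
have -> : Num.sqrt ((v + rho) / rho) = q^-1.
  by rewrite -sqrtrV ?invf_div// divr_ge0 ?ltW.
set X := (X in ln X).
have X0 : 0 < X by rewrite ltr_wpDl// !mulr_ge0 ?invr_ge0 ?mulr_ge0 ?ltW.
rewrite -ler_expR lnK ?posrE//.
have := NM_statDN rho v s.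
have -> : Num.sqrt (4 * rho / (v + rho)) = 2 * q.
  by rewrite -mulrA sqrtrM// sqrtr4.
set e := expR _ => Ee.
have Ns : NM_stat rho v (- s) + NM_stat rho v s <= q + l0 / alpha.
  apply: lerD; last exact: ltW.
  by rewrite /q -NM_stat0; apply: NM_stat_nondecreasing => //; rewrite oppr_le0.
(* Weakening [2 q e <= q + l0 / alpha] to [2 q e <= 2 q + l0 / alpha] gives the [+ 1] inside the
   logarithm. *)
have -> : X = (l0 / alpha + 2 * q) / (2 * q).
  by rewrite /X; field; rewrite !gt_eqF.
rewrite ler_pdivlMr ?mulr_gt0// mulrC -Ee; lra.
Qed.

(** Turns boundary crossing into a condition on the mixture. Left to right uses right continuity,
    right to left monotonicity. *)
Lemma NM_leP (R : realType) (l0 alpha rho v s : R) :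
  1 <= l0 -> 0 < alpha -> alpha < 1 -> 0 < rho -> 0 <= v ->
  (NM l0 alpha rho v <= s) = (l0 / alpha <= NM_stat rho v s).
Proof.
move=> l01 alpha0 alpha1 rho0 v0.
have l00 : 0 < l0 by exact: lt_le_trans l01.
pose A := [set s | NM_stat rho v s < l0 / alpha].
rewrite (_ : NM _ _ _ _ = sup A)//.
(* The value at [0] is at most [1], and [1 < l0 / alpha]. With the upper bound [ubA], [sup A] is a
   genuine supremum and not a default value. *)
have A0 : A 0.
  rewrite /A/= NM_stat0 (@le_lt_trans _ _ 1)//.
    rewrite -[leRHS]sqrtr1 ler_wsqrtr// ler_pdivrMr ?ltr_wpDl// mul1r.
    by rewrite lerDr.
  by rewrite ltr_pdivlMr// mul1r (lt_le_trans alpha1).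
have ubA : ubound A (NM_tilde l0 alpha rho v).
  by move=> t; exact: le_NM_tilde.
apply/idP/idP => [sups|cs].
  rewrite leNgt; apply/negP => /(NM_stat_right_lt (ltr_wpDl v0 rho0))[t st At].
  have : t <= sup A by apply: ub_le_sup => //; exists (NM_tilde l0 alpha rho v).
  by rewrite leNgt (le_lt_trans sups st).
apply: ge_sup; first by exists 0.
move=> t At; rewrite leNgt; apply/negP => /ltW /(NM_stat_nondecreasing rho0 v0).
by rewrite leNgt (lt_le_trans At cs).
Qed.

Theorem proposition6 (R : realType) (l0 alpha rho : R)
    (hl0 : 1 <= l0) (halpha0 : 0 < alpha) (halpha1 : alpha < 1)
    (hrho : 0 < rho) :
  sub_gaussian_uniform_boundary l0 alpha (NM l0 alpha rho) /\
  (forall v : R, 0 <= v -> NM l0 alpha rho v <= NM_tilde l0 alpha rho v).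
Proof.
have l00 : 0 < l0 by exact: lt_le_trans hl0.
split=> [d T P F S V sub|v v0]; last first.
  rewrite NM_leP// leNgt; apply/negP.
  (* Were the statistic at [NM_tilde] below [l0 / alpha], it would also be so at some
     [t > NM_tilde], against [le_NM_tilde]. *)
  move=> /(NM_stat_right_lt (ltr_wpDl v0 hrho))[t tilde_t].
  by move=> /(le_NM_tilde l00 halpha0 hrho v0); rewrite leNgt tilde_t.
have c0 : 0 < l0 / alpha by rewrite divr_gt0.
have [mE] := half_normal_mixture_maximal hrho c0 sub.
have [[_ _ _ V0] _] := sub.
rewrite (_ : l0 / (l0 / alpha) = alpha); last by field; rewrite !gt_eqF.
apply: le_trans; pose E t := [set w |
  ((l0 / alpha)%:E <= half_normal_mixture rho (S t w) (V t w))%E].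
(* As a union of the [E t] the crossing event is measurable, and the times [t >= 1] are among those
   covered by the maximal inequality. *)
have -> : [set w | exists t, (1 <= t)%N /\ NM l0 alpha rho (V t w) <= S t w] =
    \bigcup_(t in [set t | (1 <= t)%N]) E t.
  apply/seteqP; split=> [w [t [t1]]|w [t t1]].
    rewrite NM_leP// => st; exists t => //.
    by rewrite /E/= half_normal_mixtureE.
  by rewrite /E/= half_normal_mixtureE// lee_fin => st; exists t; rewrite NM_leP.
rewrite le_measure ?inE//; [| |by move=> w [t _ Et]; exists t].
- by apply: bigcup_measurable => t _; exact: mE.
- by apply: bigcup_measurable => t _; exact: mE.
Qed.
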